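(* Let $\mathcal{V}=(V,\langle\cdot,\cdot\rangle,J,R)$ be a complex model. Then $\mathcal{V}$ is complex Osserman if and only if both of the following hold: (1) $JE_\lambda(\pi_x)=E_\lambda(\pi_x)$ for all $\pi_x\in\mathbb{CP}(V,\langle\cdot,\cdot\rangle,J)$ and all $\lambda\in\operatorname{Spec}\{\mathcal{J}_R(\pi_x)\}$; (2) $\operatorname{Spec}\{\mathcal{J}_R(\pi_x)\}=\operatorname{Spec}\{\mathcal{J}_R(\pi_y)\}$ for all $\pi_x,\pi_y\in\mathbb{CP}(V,\langle\cdot,\cdot\rangle,J)$.
   Context: $V$ is a finite-dimensional real vector space. A Hermitian almost complex structure on $(V,\langle\cdot,\cdot\rangle)$ is a linear isometry $J$ with $J^2=-\operatorname{id}$. An algebraic curvature tensor is $R\in\otimes^4V^*$ with $R(x,y,z,t)=-R(y,x,z,t)=R(z,t,x,y)$ and $R(x,y,z,t)+R(y,z,x,t)+R(z,x,y,t)=0$. A complex model is a quadruple $(V,\langle\cdot,\cdot\rangle,J,R)$ with $\langle\cdot,\cdot\rangle$ a positive definite inner product, $J$ a Hermitian almost complex structure and $R$ an algebraic curvature tensor. The Jacobi operator is the linear map $\mathcal{J}_R(x)$ on $V$ determined by $\langle\mathcal{J}_R(x)y,z\rangle=R(y,x,x,z)$. For a unit vector $x$ put $\pi_x:=\operatorname{Span}\{x,Jx\}$ and $\mathcal{J}_R(\pi_x):=\mathcal{J}_R(x)+\mathcal{J}_R(Jx)$ (a self-adjoint operator depending only on $\pi_x$); $\mathbb{CP}(V,\langle\cdot,\cdot\rangle,J)$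 is the set of all $J$-invariant real $2$-planes, i.e. of all $\pi_x$. $\operatorname{Spec}\{\mathcal{J}_R(\pi_x)\}$ is the spectrum of $\mathcal{J}_R(\pi_x)$ and $E_\lambda(\pi_x)$ is its eigenspace for the eigenvalue $\lambda$. A complex model is complex Osserman if $J$ and $R$ are compatible, i.e. $\mathcal{J}_R(\pi_x)J=J\mathcal{J}_R(\pi_x)$ for all unit $x$ (equivalently $R(x,y,z,t)=R(Jx,Jy,Jz,Jt)$ for all $x,y,z,t\in V$), and the eigenvalues of $\mathcal{J}_R(\pi_x)$ are constant on $\mathbb{CP}(V,\langle\cdot,\cdot\rangle,J)$. *)

(* Defs.v *)
From HB Require Import structures.
From mathcomp Require Import all_boot all_order all_algebra.
From mathcomp Require Import boolp classical_sets reals.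
From mathcomp Require Import ring lra.
Set Implicit Arguments.
Unset Strict Implicit.
Unset Printing Implicit Defensive.

Import Order.TTheory GRing.Theory Num.Theory.
Local Open Scope classical_set_scope.
Local Open Scope ring_scope.

Definition multilinear4 (R : realType) (V : vectType R)
    (A : V -> V -> V -> V -> R) : Prop :=
  [/\ forall y z t, scalar (fun x => A x y z t),
      forall x z t, scalar (fun y => A x y z t),
      forall x y t, scalar (fun z => A x y z t)
    & forall x y z, scalar (fun t => A x y z t)].

Definition algebraic_curvature_tensor (R : realType) (V : vectType R)
    (A : V -> V -> V -> V -> R) : Prop :=
  [/\ multilinear4 A,
      forall x y z t, A x y z t = - A y x z t,
      forall x y z t, A x y z t = A z t x y
    & forall x y z t, A x y z t + A y z x t + A z x y t = 0].

Definition hermitian_almost_complex (R : realType) (V : vectType R)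
    (g : {dot V for idfun}) (J : 'End(V)) : Prop :=
  isometry g g J /\ (J \o J)%VF = - \1%VF.

Record complex_model (R : realType) := ComplexModel {
  space :> vectType R;
  inner : {dot space for idfun};
  cplx : 'End(space);
  curv : space -> space -> space -> space -> R;
  cplxP : hermitian_almost_complex inner cplx;
  curvP : algebraic_curvature_tensor curv }.

Arguments inner {R} c.
Arguments cplx {R} c.
Arguments curv {R} c.

(* The endomorphism f with <f y, z> = R(y, x, x, z); its existence and
   uniqueness are jacobiP and jacobi_unique below. *)
Definition jacobi (R : realType) (M : complex_model R) (x : M) : 'End(M) :=
  xget 0 [set f : 'End(M) | forall y z : M, inner M (f y) z = curv M y x x z].

Definition unit_vector (R : realType) (M : complex_model R) (x : M) : Prop :=
  inner M x x = 1.

Definition cline (R : realType) (M : complex_model R) (x : M) : {vspace M} :=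
  (<[x]> + <[cplx M x]>)%VS.

Definition CP (R : realType) (M : complex_model R) : set {vspace M} :=
  [set P | \dim P = 2%N /\ (cplx M @: P)%VS = P].

(* Computed from an arbitrarily chosen unit vector x with pi_x = P;
   jacobi_planeE shows that the choice is irrelevant. *)
Definition jacobi_plane (R : realType) (M : complex_model R)
    (P : {vspace M}) : 'End(M) :=
  let x := xget 0 [set x : M | unit_vector x /\ cline x = P] in
  jacobi x + jacobi (cplx M x).

Definition Spec (R : realType) (V : vectType R) (f : 'End(V)) : set R :=
  [set a | passmx.leigenvalue f a].

Definition compatible (R : realType) (M : complex_model R) : Prop :=
  forall x : M, unit_vector x ->
    (jacobi_plane (cline x) \o cplx M = cplx M \o jacobi_plane (cline x))%VF.

(* Multiplicities are not recorded. *)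
Definition constant_eigenvalues (R : realType) (M : complex_model R) : Prop :=
  forall P Q : {vspace M}, CP P -> CP Q ->
    forall a : R, passmx.leigenvalue (jacobi_plane P) a <->
                  passmx.leigenvalue (jacobi_plane Q) a.

Definition complex_osserman (R : realType) (M : complex_model R) : Prop :=
  compatible M /\ constant_eigenvalues M.

Lemma linear_lfun (R : realType) (U W : vectType R) (f : U -> W) :
  linear f -> exists F : 'Hom(U, W), F =1 f.
Proof.
move=> fl; pose h : {linear U -> W} :=
  HB.pack f (GRing.isLinear.Build R U W *:%R f fl).
by exists (linfun h) => x; rewrite lfunE.
Qed.

Section WellDefined.
Context (R : realType) (M : complex_model R).
Local Notation g := (inner M).
Local Notation J := (cplx M).
Local Notation A := (curv M).
Implicit Types x y z w : M.

Lemma inner_sym x y : g x y = g y x.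
Proof. by rewrite (hermitian_subproof (s := g)) expr0 mul1r. Qed.

Lemma inner_eq0 u : (forall z, g u z = 0) -> u = 0.
Proof.
move=> u0; apply/eqP; apply/negPn/negP => /(neq0_dnorm_gt0 (s := g)).
by rewrite u0 ltxx.
Qed.

Lemma innerDl u v w : g (u + v) w = g u w + g v w.
Proof. exact: linearDl. Qed.

Lemma innerZl a u w : g (a *: u) w = a * g u w.
Proof. exact: linearZl_LR. Qed.

Lemma innerDr u v w : g w (u + v) = g w u + g w v.
Proof. by rewrite inner_sym innerDl !(inner_sym w). Qed.

Lemma innerZr a u w : g w (a *: u) = a * g w u.
Proof. by rewrite inner_sym innerZl inner_sym. Qed.

Lemma inner_inj u v : (forall z, g u z = g v z) -> u = v.
Proof.
move=> uv; apply/eqP; rewrite -subr_eq0; apply/eqP/inner_eq0 => z.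
by rewrite -scaleN1r innerDl innerZl mulN1r uv subrr.
Qed.

Let e := vbasis (fullv : {vspace M}).
Let n := \dim (fullv : {vspace M}).

Let sh_lin (f : M -> M -> R) (fl : forall z, scalar (fun y => f y z)) :
  linear (fun y => \row_(j < n) f y e`_j : 'rV[R]_n).
Proof. by move=> a u v; apply/rowP => j; rewrite !mxE fl. Qed.

Let row_ext (f h : M -> R) : scalar f -> scalar h ->
  \row_(j < n) f e`_j = \row_(j < n) h e`_j -> f =1 h.
Proof.
move=> fl hl eqfh z.
have [F FE] := @linear_lfun _ _ (R^o : vectType R) f fl.
have [H HE] := @linear_lfun _ _ (R^o : vectType R) h hl.
rewrite -FE -HE (coord_vbasis (memvf z)) !linear_sum.
apply: eq_bigr => i _; rewrite !linearZ /= FE HE.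
by move/rowP: eqfh => /(_ i); rewrite !mxE => ->.
Qed.

Lemma riesz (b : M -> M -> R) :
  (forall z, scalar (fun y => b y z)) -> (forall y, scalar (b y)) ->
  exists f : 'End(M), forall y z, g (f y) z = b y z.
Proof.
move=> bl br.
have gl z : scalar (fun y => g y z).
  by move=> a u v; rewrite innerDl innerZl.
have gr y : scalar (g y).
  by move=> a u v; rewrite innerDr innerZr.
have [G GE] := linear_lfun (sh_lin gl).
have [B BE] := linear_lfun (sh_lin bl).
have kerG : lker G == 0%VS.
  rewrite -subv0; apply/subvP => u; rewrite memv_ker memv0 GE => /eqP Gu.
  apply/eqP/inner_eq0; apply: (row_ext (gr u) (h := fun=> 0)).
    by move=> a v w; rewrite mulr0 addr0.
  by rewrite Gu; apply/rowP => j; rewrite !mxE.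
have imG : limg G = fullv.
  apply/eqP; rewrite eqEdim subvf /= limg_dim_eq; last first.
    by rewrite (eqP kerG) capv0.
  by rewrite !dimvf /dim /= mul1n /n dimvf.
exists (G^-1 \o B)%VF => y.
apply: row_ext (gr _) (br y) _.
have : G (G^-1 (B y))%VF = B y by rewrite limg_lfunVK // imG memvf.
by rewrite comp_lfunE -GE -BE.
Qed.

Lemma jacobiP x y z : g (jacobi x y) z = A y x x z.
Proof.
have [[A1 _ _ A4] _ _ _] := curvP M.
have [f fP] := riesz (fun z => A1 x x z) (fun y => A4 y x x).
rewrite /jacobi; case: xgetP => [h _|/(_ f)]; last by case.
exact.
Qed.

Lemma jacobi_unique x (f : 'End(M)) :
  (forall y z, g (f y) z = A y x x z) -> f = jacobi x.
Proof.
by move=> fP; apply/lfunP => y; apply: inner_inj => z; rewrite fP jacobiP.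
Qed.

Lemma cplxK x : J (J x) = - x.
Proof.
have [_ /lfunP/(_ x)] := cplxP M.
by rewrite comp_lfunE opp_lfunE id_lfunE.
Qed.

Lemma inner_cplx x y : g (J x) (J y) = g x y.
Proof. by have [iJ _] := cplxP M; apply: iJ. Qed.

Lemma inner_cplx_ortho x : g x (J x) = 0.
Proof.
have : g x (J x) = - g x (J x).
  by rewrite -[LHS]inner_cplx cplxK -scaleN1r innerZr mulN1r inner_sym.
lra.
Qed.

Lemma cline_rot x y : unit_vector x -> unit_vector y -> y \in cline x ->
  exists a b : R, [/\ a ^+ 2 + b ^+ 2 = 1, y = a *: x + b *: J x
                    & J y = - b *: x + a *: J x].
Proof.
rewrite /unit_vector => ux uy.
case/memv_addP=> _ /vlineP[a ->] [_ /vlineP[b ->] yE].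
exists a, b; split=> //.
  move: uy; rewrite yE innerDl !innerDr !innerZl !innerZr inner_cplx.
  rewrite (inner_sym (J x)) inner_cplx_ortho ux => <-; ring.
by rewrite yE linearD !linearZ /= cplxK scalerN scaleNr addrC.
Qed.

Lemma jacobi_rot x (a b : R) : a ^+ 2 + b ^+ 2 = 1 ->
  jacobi (a *: x + b *: J x) + jacobi (- b *: x + a *: J x) =
  jacobi x + jacobi (J x).
Proof.
move=> ab; apply/lfunP => y; apply: inner_inj => z.
rewrite !add_lfunE !innerDl !jacobiP.
have [[_ A2 A3 _] _ _ _] := curvP M.
have A2D u v z' t : A y (u + v) z' t = A y u z' t + A y v z' t.
  by have := A2 y z' t 1 u v; rewrite /= scale1r mul1r.
have A3D u v z' t : A y z' (u + v) t = A y z' u t + A y z' v t.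
  by have := A3 y z' t 1 u v; rewrite /= scale1r mul1r.
have A20 z' t : A y 0 z' t = 0.
  by have := A2D 0 0 z' t; rewrite addr0; lra.
have A30 z' t : A y z' 0 t = 0.
  by have := A3D 0 0 z' t; rewrite addr0; lra.
have A2Z c u z' t : A y (c *: u) z' t = c * A y u z' t.
  by have := A2 y z' t c u 0; rewrite /= !addr0 A20 addr0.
have A3Z c u z' t : A y z' (c *: u) t = c * A y z' u t.
  by have := A3 y z' t c u 0; rewrite /= !addr0 A30 addr0.
rewrite !A2D !A2Z !A3D !A3Z.
set p := A y x x z; set q := A y x (J x) z.
set r := A y (J x) x z; set s := A y (J x) (J x) z.
transitivity ((a ^+ 2 + b ^+ 2) * (p + s)); first by ring.
by rewrite ab mul1r.
Qed.

Lemma jacobi_planeE x : unit_vector x ->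
  jacobi_plane (cline x) = jacobi x + jacobi (J x).
Proof.
move=> ux; rewrite /jacobi_plane.
case: xgetP => [y _ [uy yx]|/(_ x)]; last by case.
have : y \in cline x by rewrite -yx; apply: subvP (addvSl _ _) _ (memv_line y).
case/(cline_rot ux uy)=> a [b [ab yE JyE]].
by rewrite JyE yE; apply: jacobi_rot.
Qed.

Lemma unit_vector_neq0 x : unit_vector x -> x != 0.
Proof.
apply: contra_eq_neq => ->.
by rewrite -(scale0r (0 : M)) innerZl mul0r eq_sym oner_neq0.
Qed.

Lemma cline_dim x : unit_vector x -> \dim (cline x) = 2%N.
Proof.
move=> ux; have x0 := unit_vector_neq0 ux.
have ujx : unit_vector (J x) by rewrite /unit_vector inner_cplx.
rewrite /cline dimv_disjoint_sum ?dim_vline ?x0 ?(unit_vector_neq0 ujx) //.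
apply/eqP; rewrite -subv0; apply/subvP => v; rewrite memv_cap memv0.
case/andP => /vlineP[a ->] /vlineP[b ab].
have : g (a *: x) x = 0.
  by rewrite ab innerZl inner_sym inner_cplx_ortho mulr0.
by rewrite innerZl ux mulr1 => ->; rewrite scale0r.
Qed.

Lemma CP_clineP (P : {vspace M}) :
  CP P <-> exists2 x : M, unit_vector x & P = cline x.
Proof.
split=> [[dP JP]|[x ux ->]]; last first.
  split; first exact: cline_dim.
  rewrite /cline limgD !limg_line cplxK.
  have -> : (<[- x]> = <[x]> :> {vspace M})%VS.
    apply/eqP; rewrite eqEsubv -!memvE memvN memv_line /=.
    by rewrite -[in X in X \in _](opprK x) memvN memv_line.
  by rewrite addvC.
have P0 : P != 0%VS by rewrite -dimv_eq0 dP.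
pose v := vpick P; have v0 : v != 0 by rewrite vpick0.
have gv : 0 < g v v by exact: (neq0_dnorm_gt0 (s := g)).
pose x := (Num.sqrt (g v v))^-1 *: v.
have ux : unit_vector x.
  rewrite /unit_vector innerZl innerZr mulrA -invfM -expr2 sqr_sqrtr ?ltW //.
  by rewrite mulVf // gt_eqF.
have xP : x \in P by rewrite memvZ // memv_pick.
exists x => //; apply/eqP; rewrite eq_sym eqEdim cline_dim // dP leqnn andbT.
by rewrite /cline subv_add -!memvE xP -JP memv_img.
Qed.

End WellDefined.

(* Main.v *)
Require Import Defs.
From mathcomp Require Import all_boot all_order all_algebra.
From mathcomp Require Import boolp classical_sets reals.
From mathcomp Require Import complex spectral ring lra.
Set Implicit Arguments.
Unset Strict Implicit.
Unset Printing Implicit Defensive.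
Import Order.TTheory GRing.Theory Num.Theory passmx.
Local Open Scope classical_set_scope.
Local Open Scope ring_scope.

(** The operators [J_R(pi_x)] are self-adjoint, hence diagonalizable: on an
    invariant subspace the complexification has an eigenvector, self-adjointness
    forces its eigenvalue to be real, and one passes to the orthogonal
    complement. An endomorphism commutes with a diagonalizable one exactly when
    it preserves every eigenspace of it, so that (1) amounts to compatibility,
    while (2) is the constancy of the eigenvalues. *)

Definition selfadjoint (R : realType) (V : vectType R) (g : {dot V for idfun})
    (f : 'End(V)) : Prop :=
  forall u v, g (f u) v = g u (f v).

(* [u + i v] is an eigenvector of the complexification of [f] for the
   eigenvalue [a + i b]. *)
Lemma complex_eigenvector (R : rcfType) (V : vectType R) (f : 'End(V)) :
  (fullv : {vspace V}) != 0%VS ->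
  exists a b : R, exists u v : V,
    [/\ (u != 0) || (v != 0), f u = a *: u - b *: v & f v = a *: v + b *: u].
Proof.
rewrite -dimv_eq0 -lt0n => n_gt0.
have eb := vbasisP (fullv : {vspace V}).
set e := vbasis _ in eb; pose A := mxof e e f.
have [[a b] /eigenvalueP[w wA w0]] :=
  eigenvalue_closed (map_mx (real_complex R) A) n_gt0.
pose u := map_mx (@complex.Re R) w; pose v := map_mx (@complex.Im R) w.
(* [A] is real, so multiplication by it acts separately on the real part [u] and the imaginary part
   [v] of [w]. *)
have entry j : (w *m map_mx (real_complex R) A) 0 j =
    ((u *m A) 0 j +i* (v *m A) 0 j)%C.
  rewrite !mxE [RHS]complexE /= !rmorph_sum mulr_sumr -big_split.
  apply: eq_bigr => k _; rewrite !mxE; case: (w 0 k) => c d /=.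
  by apply/eqP; rewrite eq_complex /=; apply/andP; split; apply/eqP; ring.
exists a, b, (vecof e u), (vecof e v); split.
- rewrite !vecof_eq0 // -negb_and; apply: contra w0 => /andP[u0 v0].
  apply/eqP/rowP => j; move/eqP/rowP/(_ j): u0; move/eqP/rowP/(_ j): v0.
  by rewrite !mxE; case: (w 0 j) => /= ? ? -> ->.
- rewrite (hom_vecof e eb) -/A.
  suff -> : u *m A = a *: u - b *: v by rewrite linearB !linearZ.
  apply/rowP => j; have := entry j; rewrite wA !mxE.
  by case: (w 0 j) => c d /= [<- _].
- rewrite (hom_vecof e eb) -/A.
  suff -> : v *m A = a *: v + b *: u by rewrite linearD !linearZ.
  apply/rowP => j; have := entry j; rewrite wA !mxE.
  by case: (w 0 j) => c d /= [_ <-].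
Qed.

Section Spectral.
Context (R : realType) (V : vectType R) (g : {dot V for idfun}) (f : 'End(V)).
Hypothesis fsa : selfadjoint g f.

Let gC u v : g u v = g v u.
Proof. by rewrite (hermitian_subproof (s := g)) expr0 mul1r. Qed.

Let gDl u v w : g (u + v) w = g u w + g v w.
Proof. exact: linearDl. Qed.

Let gZl a u w : g (a *: u) w = a * g u w.
Proof. exact: linearZl_LR. Qed.

(** For a complex eigenvector [u + i v] with eigenvalue [a + i b], self-adjointness at the pair [u],
    [v] reads [b * (g u u + g v v) = 0]. Hence [b = 0], and whichever of [u], [v] is nonzero is a
    real eigenvector. *)
Lemma selfadjoint_eigenvector (U : {vspace V}) :
  (f @: U <= U)%VS -> U != 0%VS ->
  exists u a, [/\ u \in U, u != 0 & f u = a *: u].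
Proof.
move=> fU U0.
have fullU : (fullv : {vspace subvs_of U}) != 0%VS.
  by rewrite -dimv_eq0 dimvf -[dim _]/(\dim U) dimv_eq0.
(* The restriction of [f] to [U]; invariance of [U] makes the projection harmless. *)
pose fsub : 'End(subvs_of U) :=
  (linfun (vsproj U) \o f \o linfun (@vsval _ _ U))%VF.
have [a [b [u [v [uv0 fu fv]]]]] := complex_eigenvector fsub fullU.
have fsubE x : vsval (fsub x) = f (vsval x).
  rewrite !comp_lfunE !lfunE /= vsprojK //.
  by apply: (subvP fU); rewrite memv_img // subvsP.
move/(congr1 vsval): fu; move/(congr1 vsval): fv; rewrite !fsubE /=.
move: uv0; rewrite -!(inj_eq val_inj) /=.
have := subvsP u; have := subvsP v.
move: (vsval u) (vsval v) => {}u {}v vU uU uv0 fv fu.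
have b0 : b = 0.
  have nn x : 0 <= g x x.
    have [->|/(neq0_dnorm_gt0 (s := g))/ltW //] := eqVneq x 0.
    by rewrite linear0r.
  have pos : 0 < g u u + g v v.
    case/orP: uv0 => /(neq0_dnorm_gt0 (s := g)) p; have := nn u; have := nn v; lra.
  have := fsa u v; rewrite fu fv [RHS]gC -scaleNr !gDl !gZl (gC v u) => E.
  have : b * (g u u + g v v) = 0 by move: E; lra.
  by move/eqP; rewrite mulf_eq0 (gt_eqF pos) orbF => /eqP.
move: fu fv; rewrite b0 !scale0r subr0 addr0 => fu fv.
by case/orP: uv0 => nz; [exists u, a | exists v, a].
Qed.

(** Diagonalizability, phrased so that a linear identity need only be checked on eigenvectors: take
    for [D] the subspace where it holds. *)
Lemma selfadjoint_eigenvectors_span (D : {vspace V}) :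
  (forall u a, f u = a *: u -> u \in D) -> D = fullv.
Proof.
move=> eigD; apply/eqP; rewrite eqEsubv subvf /=.
(* Induction on dimension, over all invariant subspaces [U]. *)
have [n] := ubnP (\dim (fullv : {vspace V})).
have : (f @: fullv <= (fullv : {vspace V}))%VS by exact: subvf.
elim: n (fullv : {vspace V}) => // n IHn U fU ltUn.
have [->|U0] := eqVneq U 0%VS; first exact: sub0v.
have [u [a [uU u0 fu]]] := selfadjoint_eigenvector fU U0.
have guu : g u u != 0 by rewrite gt_eqF // (neq0_dnorm_gt0 (s := g)).
have [G GE] : exists G : 'Hom(V, R^o), G =1 (fun x => g x u).
  by apply: linear_lfun => c x y; rewrite gDl gZl.
pose W := (U :&: lker G)%VS.
have memW x : (x \in W) = (x \in U) && (g x u == 0).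
  by rewrite memv_cap memv_ker GE.
have /subvP WD : (W <= D)%VS.
  apply: IHn.
    apply/subvP => _ /memv_imgP[x + ->]; rewrite memW => /andP[xU /eqP gx].
    rewrite memW (subvP fU) ?memv_img // fsa fu gC gZl gC gx mulr0 //=.
  rewrite -ltnS (leq_trans _ ltUn) // ltnS ltn_neqAle dimvS ?capvSl // andbT.
  (* If the dimension did not drop, [u] would be orthogonal to itself. *)
  apply: contra guu => /eqP dW.
  have WU : W = U by apply/eqP; rewrite eqEdim capvSl dW leqnn.
  by move: uU; rewrite -WU memW => /andP[].
apply/subvP => x xU.
(* Subtracting from [x] its orthogonal projection onto the line of [u] leaves a vector of [W]. *)
rewrite -(subrK ((g x u / g u u) *: u) x) memvD //; last first.
  by rewrite memvZ // (eigD u a).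
apply: WD; rewrite memW memvB ?memvZ //= -scaleNr gDl gZl mulNr.
by rewrite divfK // subrr.
Qed.

End Spectral.

Lemma mem_leigenspace (F : fieldType) (V : vectType F) (f : 'End(V)) a u :
  (u \in leigenspace f a) = (f u == a *: u).
Proof.
rewrite memv_ker add_lfunE opp_lfunE scale_lfunE id_lfunE.
by rewrite subr_eq0.
Qed.

Lemma jacobi_selfadjoint (R : realType) (M : complex_model R) (x : M) :
  selfadjoint (inner M) (jacobi x).
Proof.
move=> y z; rewrite [RHS]inner_sym !jacobiP.
have [_ antisym pairsym _] := curvP M.
by rewrite pairsym antisym pairsym antisym opprK pairsym.
Qed.

(** Whatever vector [xget] returns, its default 0 included, the operator is a sum of two Jacobi
    operators. *)
Lemma jacobi_plane_selfadjoint (R : realType) (M : complex_model R)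
  (P : {vspace M}) : selfadjoint (inner M) (jacobi_plane P).
Proof.
move=> y z; rewrite /jacobi_plane !add_lfunE innerDl innerDr.
by rewrite !jacobi_selfadjoint.
Qed.

Lemma cplx_inj (R : realType) (M : complex_model R) : lker (cplx M) == 0%VS.
Proof.
apply/lker0P => u v /(congr1 (cplx M)); rewrite !cplxK.
exact: oppr_inj.
Qed.

Lemma selfadjoint_commuteP (R : realType) (M : complex_model R) (f : 'End(M)) :
  selfadjoint (inner M) f ->
  (f \o cplx M = cplx M \o f)%VF <->
  (forall a, Spec f a ->
     (cplx M @: leigenspace f a)%VS = leigenspace f a).
Proof.
move=> fsa; split=> [fJ a _|JE].
  (* Injectivity of [cplx M] preserves the dimension, so one inclusion suffices. *)
  apply/eqP; rewrite eqEdim (limg_dim_eq (f := cplx M)); last first.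
    by rewrite (eqP (cplx_inj M)) capv0.
  rewrite leqnn andbT; apply/subvP => _ /memv_imgP[u uE ->].
  move: uE; rewrite !mem_leigenspace => /eqP fu.
  by rewrite -comp_lfunE fJ comp_lfunE fu linearZ.
apply/lfunP => v; apply/eqlfunP.
(* [D] is the kernel of the commutator of [f] and [cplx M]. *)
rewrite (selfadjoint_eigenvectors_span fsa (D := lker _)) ?memvf // => u a fu.
apply/eqlfunP; rewrite !comp_lfunE fu.
have [->|u0] := eqVneq u 0; first by rewrite scaler0 !linear0.
have uE : u \in leigenspace f a by rewrite mem_leigenspace fu.
have Ea : Spec f a by apply: contra u0 => /eqP E0; rewrite -memv0 -E0.
rewrite linearZ; apply/eqP; rewrite -mem_leigenspace -(JE a Ea).
exact: memv_img.
Qed.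

Theorem lemma2p2 (R : realType) (M : complex_model R) :
  complex_osserman M <->
  (forall P : {vspace M}, CP P ->
     forall lambda : R, Spec (jacobi_plane P) lambda ->
       (cplx M @: passmx.leigenspace (jacobi_plane P) lambda)%VS =
       passmx.leigenspace (jacobi_plane P) lambda) /\
  (forall P Q : {vspace M}, CP P -> CP Q ->
     Spec (jacobi_plane P) = Spec (jacobi_plane Q)).
Proof.
split=> [[comp const]|[JE Seq]]; split.
(* Compatibility ranges over unit vectors and (1) over planes; [CP_clineP] translates between
   them. *)
- move=> P /CP_clineP[x ux ->].
  exact/selfadjoint_commuteP/comp/ux/jacobi_plane_selfadjoint.
- by move=> P Q CPP CPQ; apply/funext => a; apply/propext/(const P Q CPP CPQ a).
- move=> x ux; apply/(selfadjoint_commuteP (@jacobi_plane_selfadjoint _ _ _)).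
  by apply: JE; apply/CP_clineP; exists x.
- move=> P Q CPP CPQ a.
  have : Spec (jacobi_plane P) a = Spec (jacobi_plane Q) a by rewrite (Seq P Q).
  by rewrite /Spec /mkset => ->.
Qed.
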